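(* Let $k\ge r\ge 1$ be integers, let $\ell=\lceil k/2\rceil$, and let $\mathcal{F}$ be a family of $n$ distinct $\ell$-subsets of $[k]$. Suppose that there exists an $[r]$-preserving and $[r]$-intersection shifting bijection $h:\mathcal{F}\to\mathcal{F}$. Then the matrix $C_n$ is $(r,k-r,k-r)$-coverable. In particular, $\mathrm{R}_{\mathbb{B}}(C_n\otimes C_n)\le k^2-r^2$.
   Context: $[k]=\{1,\ldots,k\}$ and for $F\subseteq[k]$, $\overline{F}=[k]\setminus F$. For a family $\mathcal{F}$ of subsets of $[k]$, $L\subseteq[k]$ and a function $h:\mathcal{F}\to\mathcal{F}$: $h$ is $L$-preserving if $D\cap L=h(D)\cap L$ for every $D\in\mathcal{F}$; $h$ is $L$-intersection shifting if for every $D,E\in\mathcal{F}$ with $\emptyset\ne D\cap\overline{E}\subseteq L$ it holds that $(h(D)\cap\overline{h(E)})\setminus L\ne\emptyset$. $C_n$ is the $n\times n$ $0,1$-matrix with zeros on the diagonal and ones elsewhere. The Boolean rank $\mathrm{R}_{\mathbb{B}}(A)$ of a $0,1$-matrix is the smallest number of all-ones combinatorial rectangles needed to cover its $1$-entries. A collection of $0,1$-matrices covers $A$ if $A_{i,j}=1$ iff some matrix of the collection has a $1$ in entry $(i,j)$. $A$ is $(a_1,a_2,a_3)$-coverable if there exist three matrices $A_1,A_2,A_3$ with $\mathrm{R}_{\mathbb{B}}(A_i)\le a_i$ for all $i$ such that every two of them cover $A$. The Kronecker product $A\otimes B$ is the block matrix with $(i,j)$-th block $A_{i,j}B$. *)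

(* Defs.v *)
From mathcomp Require Export all_boot all_algebra.
From mathcomp Require Export mxtens.

Set Implicit Arguments.
Unset Strict Implicit.
Unset Printing Implicit Defensive.

(* 0,1-matrices are matrices over bool. The ring structure of bool has
   multiplication (_ && _), so the Kronecker product of 0,1-matrices is the
   library's A *t B, whose (i, j)-th block is A i j B. *)

Section BooleanRank.

Variables m n : nat.
Implicit Types (A B : 'M[bool]_(m, n)).

(* The pair (X, Y) stands for the combinatorial rectangle X x Y. *)
Definition rect : finType := ({set 'I_m} * {set 'I_n})%type.

Implicit Types (Q : rect) (S : {set rect}).

Definition all_ones A Q := [forall i in Q.1, forall j in Q.2, A i j].

Definition rect_cover A S :=
  [forall Q in S, all_ones A Q] &&
  [forall i, forall j, A i j ==> [exists Q in S, (i \in Q.1) && (j \in Q.2)]].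

Definition bool_rank A : nat :=
  #|[arg min_(S < [set Q | all_ones A Q] | rect_cover A S) #|S|]|.

Lemma rect_cover_all_ones A : rect_cover A [set Q | all_ones A Q].
Proof.
apply/andP; split; first by apply/forall_inP => Q; rewrite inE.
apply/forallP => i; apply/forallP => j; apply/implyP => Aij.
apply/exists_inP; exists ([set i], [set j]); last by rewrite !set11.
rewrite inE; apply/forall_inP => i' /set1P -> /=.
by apply/forall_inP => j' /set1P ->.
Qed.

Lemma bool_rankP A (N : nat) :
  reflect (exists2 S, rect_cover A S & #|S| <= N) (bool_rank A <= N).
Proof.
rewrite /bool_rank; case: arg_minnP; first exact: rect_cover_all_ones.
move=> S0 cS0 minS0; apply: (iffP idP) => [le_N|[S cS]]; first by exists S0.
exact/leq_trans/minS0.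
Qed.

Definition covers (s : seq 'M[bool]_(m, n)) A :=
  forall i j, A i j <-> exists2 B, B \in s & B i j.

Definition coverable (a1 a2 a3 : nat) A :=
  exists A1 A2 A3 : 'M[bool]_(m, n),
    [/\ bool_rank A1 <= a1, bool_rank A2 <= a2 & bool_rank A3 <= a3] /\
    [/\ covers [:: A1; A2] A, covers [:: A1; A3] A & covers [:: A2; A3] A].

End BooleanRank.

Definition Cmx (n : nat) : 'M[bool]_n := \matrix_(i, j) (i != j).

Section Shifting.

Variables (k : nat) (F : {set {set 'I_k}}) (L : {set 'I_k}).
Variable h : {D : {set 'I_k} | D \in F} -> {D : {set 'I_k} | D \in F}.

Definition preserving := forall D, val D :&: L = val (h D) :&: L.

Definition intersection_shifting :=
  forall D E, val D :&: ~: val E != set0 -> val D :&: ~: val E \subset L ->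
    (val (h D) :&: ~: val (h E)) :\: L != set0.

End Shifting.

(* [k] = {1, ..., k} is represented by 'I_k = {0, ..., k - 1}, so the subset
   [r] of [k] becomes the set of the i < r. *)
Definition initial (k r : nat) : {set 'I_k} := [set i : 'I_k | i < r].
Arguments initial : clear implicits.

(* Main.v *)
Require Import Defs.

Set Implicit Arguments.
Unset Strict Implicit.
Unset Printing Implicit Defensive.

(** Number the members of the family as D_1, ..., D_n. Each x in [k] gives the
    rectangle {i | x in D_i} x {j | x notin D_j}, and since the D_i form an
    antichain these k rectangles cover C_n. Let A1 collect those with x in [r],
    A2 those with x outside [r], and A3 the ones outside [r] for the family
    h(D_1), ..., h(D_n). As h preserves traces on [r], A1 is the same for both
    families, so A1 covers C_n together with A2 or with A3; intersection
    shifting says that A3 is 1 wherever A2 fails.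

    If every two of A1, A2, A3 cover A and every two of B1, B2, B3 cover B, then
    at a 1-entry of A (x) B at most one A_i and at most one B_j vanish, so
    A1 (x) B2, A2 (x) B1 and A3 (x) B3 cover A (x) B, and
    2 r (k - r) + (k - r)^2 = k^2 - r^2. *)

Section BoolRank.

(** Lets rectangles be indexed by any finite type: indices sharing a rectangle only make the cover
    smaller. *)
Lemma bool_rank_family (m n : nat) (T : finType) (A : 'M[bool]_(m, n))
    (P : {set T}) (X : T -> {set 'I_m}) (Y : T -> {set 'I_n}) :
    (forall i j, A i j = [exists x in P, (i \in X x) && (j \in Y x)]) ->
  bool_rank A <= #|P|.
Proof.
move=> AE; apply/bool_rankP; exists [set (X x, Y x) | x in P].
  apply/andP; split.
    apply/forall_inP => _ /imsetP[x Px ->].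
    apply/forall_inP => i iX; apply/forall_inP => j jY.
    by rewrite AE; apply/exists_inP; exists x; rewrite // iX.
  apply/forallP => i; apply/forallP => j; apply/implyP.
  rewrite AE => /exists_inP[x Px xij]; apply/exists_inP.
  by exists (X x, Y x) => //; apply: imset_f.
exact: leq_imset_card.
Qed.

Lemma bool_rank_rects (m n : nat) (A : 'M[bool]_(m, n)) :
  exists2 S : {set rect m n}, #|S| = bool_rank A
    & forall i j, A i j = [exists Q in S, (i \in Q.1) && (j \in Q.2)].
Proof.
have /bool_rankP[S covS leS] := leqnn (bool_rank A).
exists S; first by apply/eqP; rewrite eqn_leq leS; apply/bool_rankP; exists S.
case/andP: covS => /forall_inP onesS /forallP covS i j.
apply/idP/exists_inP => [Aij|[Q QS /andP[iQ jQ]]].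
  by apply/exists_inP; apply: implyP Aij; apply/forallP: j.
by have /forall_inP/(_ i iQ)/forall_inP/(_ j jQ) := onesS Q QS.
Qed.

Lemma bool_rank_or (m n : nat) (A B C : 'M[bool]_(m, n)) :
  (forall i j, A i j = B i j || C i j) ->
  bool_rank A <= bool_rank B + bool_rank C.
Proof.
move=> AE; have [S <- BE] := bool_rank_rects B.
have [T <- CE] := bool_rank_rects C.
apply: leq_trans (_ : #|S :|: T| <= _); last by rewrite cardsU leq_subr.
apply: (bool_rank_family (X := fst) (Y := snd)) => i j; rewrite AE BE CE.
apply/orP/exists_inP => [[] /exists_inP[Q QST Qij]|[Q /setUP[] QST Qij]].
- by exists Q; rewrite // inE QST.
- by exists Q; rewrite // inE QST orbT.
- by left; apply/exists_inP; exists Q.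
- by right; apply/exists_inP; exists Q.
Qed.

(** A product of two rectangles is a rectangle, so pairs taken from optimal covers of [A] and [B]
    cover [A *t B]. *)
Lemma bool_rank_tens (m n p q : nat) (A : 'M[bool]_(m, n))
    (B : 'M[bool]_(p, q)) :
  bool_rank (A *t B) <= bool_rank A * bool_rank B.
Proof.
have [S <- AE] := bool_rank_rects A; have [T <- BE] := bool_rank_rects B.
rewrite -cardsX.
apply: (bool_rank_family
  (X := fun Q : rect m n * rect p q =>
     [set i | ((mxtens_unindex i).1 \in Q.1.1) && ((mxtens_unindex i).2 \in Q.2.1)])
  (Y := fun Q : rect m n * rect p q =>
     [set j | ((mxtens_unindex j).1 \in Q.1.2) && ((mxtens_unindex j).2 \in Q.2.2)])) => i j.
rewrite mxE AE BE.
apply/andP/exists_inP => [[/exists_inP[Q QS /andP[Qi Qj]]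
                           /exists_inP[Q' QT /andP[Qi' Qj']]]|[[Q Q']]].
  by exists (Q, Q'); rewrite !inE /= ?QS ?QT // Qi Qj Qi'.
rewrite !inE /= => /andP[QS QT] /andP[/andP[Qi Qi'] /andP[Qj Qj']].
by split; apply/exists_inP; [exists Q|exists Q']; rewrite // ?Qi ?Qi'.
Qed.

Lemma covers2P (m n : nat) (A B C : 'M[bool]_(m, n)) :
  covers [:: B; C] A <-> forall i j, A i j = B i j || C i j.
Proof.
have memE i j : (exists2 M, M \in [:: B; C] & M i j) <-> B i j || C i j.
  split=> [[M]|/orP[] Mij]; last 2 first.
  - by exists B; rewrite // mem_head.
  - by exists C; rewrite // !inE eqxx orbT.
  by rewrite !inE => /orP[] /eqP-> ->; rewrite ?orbT.
split=> [cov i j|AE i j]; last by rewrite AE; split; apply memE.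
by apply/idP/idP => [/cov/memE|/memE/cov].
Qed.

Lemma coverable_bool_rank_tens (m n p q a1 a2 a3 b1 b2 b3 : nat)
    (A : 'M[bool]_(m, n)) (B : 'M[bool]_(p, q)) :
    coverable a1 a2 a3 A -> coverable b1 b2 b3 B ->
  bool_rank (A *t B) <= a1 * b2 + a2 * b1 + a3 * b3.
Proof.
case=> [A1 [A2 [A3 [[rA1 rA2 rA3]]]]] [/covers2P A12 /covers2P A13 /covers2P A23].
case=> [B1 [B2 [B3 [[rB1 rB2 rB3]]]]] [/covers2P B12 /covers2P B13 /covers2P B23].
pose U := map2_mx orb (A1 *t B2) (A2 *t B1).
have rank_le (c d : nat) (C : 'M[bool]_(m, n)) (D : 'M[bool]_(p, q)) :
    bool_rank C <= c -> bool_rank D <= d -> bool_rank (C *t D) <= c * d.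
  by move=> rC rD; apply: leq_trans (bool_rank_tens C D) (leq_mul rC rD).
have rU : bool_rank U <= a1 * b2 + a2 * b1.
  apply: leq_trans (bool_rank_or (B := A1 *t B2) (C := A2 *t B1) _) _.
    by move=> i j; rewrite mxE.
  by apply: leq_add; apply: rank_le.
apply: leq_trans (bool_rank_or (B := U) (C := A3 *t B3) _) _; last first.
  by apply: leq_add => //; apply: rank_le.
move=> i j; rewrite !mxE.
move: (mxtens_unindex i) (mxtens_unindex j) => [i1 i2] [j1 j2] /=.
move: (A12 i1 j1) (A13 i1 j1) (A23 i1 j1) (B12 i2 j2) (B13 i2 j2) (B23 i2 j2).
(* The cases left open have [A] equal to 1 and at most one of [A1], [A2], [A3] equal to 0. *)
case: (A i1 j1) (A1 i1 j1) (A2 i1 j1) (A3 i1 j1) => [] [] [] [] //= _ _ _;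
by case: (B i2 j2) (B1 i2 j2) (B2 i2 j2) (B3 i2 j2) => [] [] [] [].
Qed.

End BoolRank.

Section CoverFromSets.

Variables (T : finType) (n : nat).
Implicit Types (L M : {set T}) (D E : 'I_n -> {set T}).

(** The union of the rectangles of the points of [M]: [M = L] gives A1, and [M = ~: L] gives A2 or,
    for the shifted family, A3. *)
Definition diff_mx M D : 'M[bool]_n :=
  \matrix_(i, j) (D i :&: ~: D j :&: M != set0).

Lemma bool_rank_diff_mx M D : bool_rank (diff_mx M D) <= #|M|.
Proof.
apply: (bool_rank_family (X := fun x => [set i | x \in D i])
                         (Y := fun x => [set j | x \notin D j])) => i j.
rewrite mxE; apply/set0Pn/exists_inP => [[x]|[x xM]].
  by rewrite !inE => /andP[/andP[xi xj] xM]; exists x; rewrite // !inE xi.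
by rewrite !inE => xij; exists x; rewrite !inE xij.
Qed.

Lemma Cmx_diff_mx L D :
    (forall i j, i != j -> D i :&: ~: D j != set0) ->
  forall i j, Cmx n i j = diff_mx L D i j || diff_mx (~: L) D i j.
Proof.
(* The parts inside and outside [L] rejoin to [D i :&: ~: D j], which is empty exactly on the
   diagonal. *)
move=> antiD i j; rewrite !mxE -negb_and -setU_eq0 -setIUr setUCr setIT.
by have [->|/antiD->//] := eqVneq i j; rewrite setICr eqxx.
Qed.

Lemma coverable_Cmx_sets L D E :
    (forall i j, i != j -> D i :&: ~: D j != set0) ->
    (forall i j, i != j -> E i :&: ~: E j != set0) ->
    (forall i, D i :&: L = E i :&: L) ->
    (forall i j, D i :&: ~: D j != set0 -> D i :&: ~: D j \subset L ->
       (E i :&: ~: E j) :\: L != set0) ->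
  coverable #|L| #|~: L| #|~: L| (Cmx n).
Proof.
move=> antiD antiE DEL shift.
have LE i j : diff_mx L D i j = diff_mx L E i j.
  rewrite !mxE; congr (_ != _); apply/setP => x; rewrite !inE.
  have [xL|] := boolP (x \in L); last by rewrite !andbF.
  have DEx u : (x \in D u) = (x \in E u).
    by have /setP/(_ x) := DEL u; rewrite !inE xL !andbT.
  by rewrite !DEx.
exists (diff_mx L D), (diff_mx (~: L) D), (diff_mx (~: L) E).
split; first by split; apply: bool_rank_diff_mx.
split; apply/covers2P => i j; first exact: Cmx_diff_mx.
  by rewrite LE; apply: Cmx_diff_mx.
apply/idP/orP => [|[] Dij]; last 2 first.
- by rewrite (Cmx_diff_mx L antiD) Dij orbT.
- by rewrite (Cmx_diff_mx L antiE) Dij orbT.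
rewrite mxE => /antiD Dij; rewrite !mxE.
(* If A2 vanishes at [(i, j)], the nonempty set [D i :&: ~: D j] lies inside [L], so [shift]
   applies. *)
have [DL|] := eqVneq (D i :&: ~: D j :&: ~: L) set0; last by left.
right; rewrite -setDE; apply: shift => //.
by rewrite -setD_eq0 setDE DL.
Qed.

End CoverFromSets.

(** An inclusion between finite sets of equal size is an equality; this makes a uniform family an
    antichain. *)
Lemma setIC_neq0_card (T : finType) (A B : {set T}) :
  #|A| = #|B| -> A != B -> A :&: ~: B != set0.
Proof.
by move=> cAB; apply: contraNN; rewrite -setDE setD_eq0 eqEcard cAB leqnn andbT.
Qed.

Lemma card_initial (k r : nat) : r <= k -> #|initial k r| = r.
Proof.
move=> le_rk.
have widen_inj : injective (widen_ord le_rk).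
  by move=> i j /(congr1 val) /= /val_inj.
rewrite -[RHS]card_ord -(card_imset _ widen_inj).
apply: eq_card => i; rewrite inE; apply/idP/imsetP => [lt_ir|[j _ ->]]; last first.
  exact: (ltn_ord j).
by exists (Ordinal lt_ir) => //; apply: val_inj.
Qed.

Theorem theorem4 (k r n : nat) (r_ge1 : 1 <= r) (le_rk : r <= k)
    (F : {set {set 'I_k}})
    (card_F : #|F| = n)
    (card_in_F : forall D : {set 'I_k}, D \in F -> #|D| = uphalf k)
    (ex_h : exists h : {D : {set 'I_k} | D \in F} -> {D : {set 'I_k} | D \in F},
        [/\ bijective h,
            preserving (initial k r) h &
            intersection_shifting (initial k r) h]) :
  coverable r (k - r) (k - r) (Cmx n) /\
  bool_rank (Cmx n *t Cmx n) <= k ^ 2 - r ^ 2.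
Proof.
have covC : coverable r (k - r) (k - r) (Cmx n).
  case: ex_h => h [/bij_inj h_inj h_pres h_shift]; case: n / card_F.
  pose d (i : 'I_#|F|) : {D | D \in F} := exist _ (enum_val i) (enum_valP i).
  have d_inj : injective d by move=> i j /(congr1 val); apply: enum_val_inj.
  (* Stated for any injective numbering, since it serves both [d] and [h \o d]. *)
  have anti f : injective f -> forall i j : 'I_#|F|, i != j ->
      val (f i : {D | D \in F}) :&: ~: val (f j) != set0.
    move=> f_inj i j neq_ij; apply: setIC_neq0_card.
      by rewrite !card_in_F //; apply: valP.
    by apply: contraNneq neq_ij => /val_inj/f_inj->.
  have := coverable_Cmx_sets (L := initial k r) (anti d d_inj)
    (anti (h \o d) (inj_comp h_inj d_inj)) (fun i => h_pres (d i))
    (fun i j => h_shift (d i) (d j)).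
  by rewrite [#|~: _|]cardsCs setCK card_ord card_initial.
split=> //; apply: leq_trans (coverable_bool_rank_tens covC covC) _.
(* Factoring out [k - r] leaves [r + (r + (k - r))], which is [r + k] because [r <= k]. *)
by rewrite subn_sqr (mulnC r) -!mulnDr -addnA subnKC // addnC.
Qed.
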